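(* Let $G_0 \xleftarrow{\varphi_0} G_1 \xleftarrow{\varphi_1} G_2 \xleftarrow{\varphi_2}\cdots$ be a sequence of covers of graphs with inverse limit $(X,f)$, and let $\mu\in\mathcal{P}_f$ be an ergodic measure. Let $\mathbf{N}\subseteq\mathbb{N}$ be an infinite subset and suppose that $\mathcal{C}=\{\mathcal{C}_n\}_{n\in\mathbf{N}}$ is a system of circuits enumerated by $\mathbf{N}$ that expresses $\mu$. Then $\bar\mu\in\overline{\mathcal{C}}_\infty$.
   Context: A graph is a pair $G=(V,E)$ with $V$ a finite set and $E \subseteq V\times V$ such that for each $v\in V$ there are edges $(u_1,v),(v,u_2)\in E$. A graph homomorphism $\varphi:(V_1,E_1)\to(V_2,E_2)$ is a map $\varphi:V_1\to V_2$ with $(\varphi\times\varphi)(E_1)\subseteq E_2$; for $e=(u,v)\in E_1$ write $\varphi(e)=(\varphi(u),\varphi(v))$. It is a cover if $(\varphi\times\varphi)(E_1)=E_2$ and $(u,v),(u,v')\in E_1$ implies $\varphi(v)=\varphi(v')$. In a sequence of covers, write $G_n=(V_n,E_n)$, $n\in\mathbb{N}=\{0,1,2,\dots\}$; each $\varphi_n:G_{n+1}\to G_n$ is a cover and $G_0=(\{0\},\{(0,0)\})$. For $m>n$, $\varphi_{m,n}:=\varphi_n\circ\cdots\circ\varphi_{m-1}$. The inverse limit $(X,f)$ is: $X=\{(x_0,x_1,\dots)\in\prod_i V_i : x_i=\varphi_i(x_{i+1})\ \forall i\}$ with the product topology, and $f:X\to X$ is the continuous surjection whose graph is $\{(x,y):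 (x_i,y_i)\in E_i\ \forall i\}$. For $v\in V_n$, $U(v)=\{x\in X:x_n=v\}$; for $e=(u,v)\in E_n$, $U(e)=U(u)\cap f^{-1}(U(v))$. $\mathcal{P}_f$ is the set of $f$-invariant Borel probability measures on $X$. For a graph $G=(V,E)$, $\mathcal{P}(G)$ is the set of formal sums $\sum_{e\in E}a(e)e$ (in $\mathbb{R}^E$) with all $a(e)\ge0$, $\sum_e a(e)=1$, and, for every $v\in V$, $\sum_{(u,v)\in E}a((u,v))=\sum_{(v,u)\in E}a((v,u))$. Put $\Delta_n=\mathcal{P}(G_n)$; for $m>n$, $\xi_{m,n}:\Delta_m\to\Delta_n$ is $\xi_{m,n}(\sum a(e)e)=\sum a(e)\varphi_{m,n}(e)$; $\Delta_\infty=\{(x_0,x_1,\dots): x_i\in\Delta_i,\ \xi_{m,n}(x_m)=x_n\ \forall m>n\}$. For $\mu\in\mathcal{P}_f$, $\bar\mu=(\mu_0,\mu_1,\dots)\in\Delta_\infty$ with $\mu_n=\sum_{e\in E_n}\mu(U(e))e$. A circuit of $G$ is a closed walk $(v_0,\dots,v_l)$, $l\ge1$, $(v_i,v_{i+1})\in E$, $v_0=v_l$, with $v_0,\dots,v_{l-1}$ pairwise distinct, regarded as a subgraph $c$ with edge set $E(c)$ and period $\mathrm{Per}(c)=l$; $\mathrm{Circ}(G)$ is the set of all circuits. A circuit $c$ is identified with $\sum_{e\in E(c)}e$, and $\tilde{c}=(1/\mathrm{Per}(c))\,c\in\mathcal{P}(G)$. A system of circuits enumerated by $\mathbf{N}$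 is a sequence $\mathcal{C}=\{\mathcal{C}_n\}_{n\in\mathbf{N}}$ with $\mathcal{C}_n\subseteq\mathrm{Circ}(G_n)$. It expresses $\mu$ if for all $n\in\mathbf{N}$, $\mu_n=\sum_{c\in\mathcal{C}_n}s(c)\tilde{c}$ for some $s(c)\ge0$ ($c\in\mathcal{C}_n$). For a sequence $x_n\in\Delta_n$ ($n\in\mathbf{N}$), $\lim_{n\to\infty}x_n$ exists and equals $(y_0,y_1,\dots)\in\Delta_\infty$ if for every $m\in\mathbb{N}$, $\xi_{n,m}(x_n)\to y_m$ as $n\to\infty$, $n\in\mathbf{N}$. $\mathcal{C}_\infty$ is the set of sequences $\{c_n\}_{n\in\mathbf{N}}$ with $c_n\in\mathcal{C}_n$ for all $n\in\mathbf{N}$ such that $\lim_{n\to\infty}\tilde{c}_n$ exists, and $\overline{\mathcal{C}}_\infty\subseteq\Delta_\infty$ is the set of all limits $\lim_{n\to\infty}\tilde{c}_n$ of such sequences. *)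

(* Defs.v *)
From HB Require Import structures.
From mathcomp Require Import all_boot all_order all_algebra.
From mathcomp Require Import all_classical all_reals all_analysis.

Set Implicit Arguments.
Unset Strict Implicit.
Unset Printing Implicit Defensive.

Import Order.TTheory GRing.Theory Num.Theory.
Import numFieldNormedType.Exports.

Local Open Scope classical_set_scope.
Local Open Scope ring_scope.

Record graph := Graph {
  vertex :> finType;
  edge : rel vertex;
  edge_in : forall v, exists u, edge u v;
  edge_out : forall v, exists w, edge v w }.

Arguments edge {g}.

Definition edges (G : graph) : Type := {e : G * G | edge e.1 e.2}.

HB.instance Definition _ (G : graph) :=
  SubFinite.copy (edges G) {e : G * G | edge e.1 e.2}.

Definition src (G : graph) (e : edges G) : G := (val e).1.
Definition tgt (G : graph) (e : edges G) : G := (val e).2.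

Record ghom (G H : graph) := GHom {
  ghom_fun :> G -> H;
  ghom_edge : forall u v, edge u v -> edge (ghom_fun u) (ghom_fun v) }.

Definition ghom_id (G : graph) : ghom G G :=
  @GHom G G id (fun u v uv => uv).

Definition ghom_comp (G H K : graph) (g : ghom H K) (f : ghom G H) :
  ghom G K := @GHom G K (g \o f) (fun u v uv => ghom_edge g (ghom_edge f uv)).

Definition edge_map (G H : graph) (f : ghom G H) (e : edges G) : edges H :=
  exist _ (f (src e), f (tgt e)) (ghom_edge f (valP e)).

(* Since f is a homomorphism, the first clause says (f x f)(E_G) = E_H. *)
Definition is_cover (G H : graph) (f : ghom G H) : Prop :=
  (forall e : edges H, exists e' : edges G, edge_map f e' = e) /\
  (forall u v v' : G, edge u v -> edge u v' -> f v = f v').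

(* By edge_out, a graph with a single vertex is ({0}, {(0, 0)}). *)
Record cover_seq := CoverSeq {
  cs_graph :> nat -> graph;
  cs_map : forall n, ghom (cs_graph n.+1) (cs_graph n);
  cs_cover : forall n, is_cover (cs_map n);
  cs_graph0 : #|cs_graph 0%N| = 1%N }.

(* phi_{k + n, n}; the offset k = m - n avoids casts between the types of
   vertices. *)
Fixpoint cs_proj (S : cover_seq) (k n : nat) : ghom (S (k + n)%N) (S n) :=
  match k return ghom (S (k + n)%N) (S n) with
  | 0 => ghom_id (S n)
  | k'.+1 => ghom_comp (cs_proj S k' n) (cs_map S (k' + n)%N)
  end.

Definition threads (S : cover_seq) :
    set (prod_topology (fun n => discrete_topology (S n))) :=
  [set x | forall i, x i = cs_map S i (x i.+1)].
Arguments threads : clear implicits.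

Definition invlim (S : cover_seq) : Type := set_type (threads S).

HB.instance Definition _ (S : cover_seq) :=
  Topological.copy (invlim S) (set_type (threads S)).

Section InverseLimitMap.
Variable S : cover_seq.

Definition thread_coord (x : invlim S) (i : nat) : S i := (val x) i.

Lemma thread_coordE (x : invlim S) i :
  thread_coord x i = cs_map S i (thread_coord x i.+1).
Proof. by have /set_mem := valP x; apply. Qed.

Lemma thread_coord_inj (x y : invlim S) :
  (forall i, thread_coord x i = thread_coord y i) -> x = y.
Proof. by move=> xy; apply/val_inj/functional_extensionality_dep. Qed.

Lemma cs_map_surj n (v : S n) : exists u, cs_map S n u == v.
Proof.
have [w vw] := edge_out v.
have [e he] := (cs_cover S n).1 (exist _ (v, w) vw).
by exists (src e); move/(congr1 (fun e => (val e).1)): he => /= ->.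
Qed.

Lemma cs_inhab : exists v : S 0%N, true.
Proof.
have : (0 < #|S 0%N|)%N by rewrite cs_graph0.
by case/card_gt0P=> v _; exists v.
Qed.

Fixpoint thread0 (n : nat) : S n :=
  match n return S n with
  | 0 => xchoose cs_inhab
  | n'.+1 => xchoose (cs_map_surj (thread0 n'))
  end.

Lemma thread0P : thread0 \in threads S.
Proof. by apply/mem_set => i; rewrite (eqP (xchooseP (cs_map_surj _))). Qed.

HB.instance Definition _ :=
  isPointed.Build (invlim S) (exist _ (thread0 : prod_topology _) thread0P).

Definition succ_vertex (G : graph) (v : G) : G := xchoose (edge_out v).

Lemma succ_vertexP (G : graph) (v : G) : edge v (succ_vertex v).
Proof. exact: xchooseP. Qed.

Definition invlim_fun (x : invlim S) (i : nat) : S i :=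
  cs_map S i (succ_vertex (thread_coord x i.+1)).

Lemma invlim_funP (x : invlim S) : invlim_fun x \in threads S.
Proof.
apply/mem_set => i; rewrite /invlim_fun.
apply: (cs_cover S i).2 (succ_vertexP _) _.
by rewrite thread_coordE; apply: ghom_edge; exact: succ_vertexP.
Qed.

(* By the second clause of is_cover, f(x)_i is the image under phi_i of any
   successor of x_{i+1}; invlim_mapP states that the graph of f is
   {(x, y) | (x_i, y_i) in E_i for all i}. *)
Definition invlim_map (x : invlim S) : invlim S :=
  exist _ (invlim_fun x : prod_topology _) (invlim_funP x).

Lemma invlim_mapP (x y : invlim S) :
  y = invlim_map x <-> forall i, edge (thread_coord x i) (thread_coord y i).
Proof.
split=> [-> i|xy].
  by rewrite thread_coordE; apply: ghom_edge; exact: succ_vertexP.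
apply: thread_coord_inj => i; rewrite thread_coordE.
exact: (cs_cover S i).2 (xy i.+1) (succ_vertexP _).
Qed.

Definition cylinder_vertex n (v : S n) : set (invlim S) :=
  [set x | thread_coord x n = v].

Definition cylinder_edge n (e : edges (S n)) : set (invlim S) :=
  cylinder_vertex (src e) `&` invlim_map @^-1` cylinder_vertex (tgt e).

End InverseLimitMap.

Definition borel_invlim (S : cover_seq) :=
  g_sigma_algebraType (@open (invlim S)).

Section Measures.
Variables (R : realType) (S : cover_seq).

Definition invariant_measure (mu : probability (borel_invlim S) R) : Prop :=
  forall A : set (borel_invlim S), measurable A ->
    mu (@invlim_map S @^-1` A) = mu A.

Definition ergodic_measure (mu : probability (borel_invlim S) R) : Prop :=
  invariant_measure mu /\
  forall A : set (borel_invlim S), measurable A ->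
    @invlim_map S @^-1` A = A -> mu A = 0%E \/ mu A = 1%E.

End Measures.

(* R^E with its product topology. *)
Notation edge_weight R G := {ptws edges G -> R}.

Definition simplex (R : realType) (G : graph) : set (edge_weight R G) :=
  [set a | [/\ forall e, 0 <= a e,
               \sum_e a e = 1 &
               forall v : G, \sum_(e | src e == v) a e =
                             \sum_(e | tgt e == v) a e]].

(* The coefficients of the formal sum \sum_e a(e) f(e). *)
Definition push (R : realType) (G H : graph) (f : ghom G H) (a : edge_weight R G) :
  edge_weight R H := fun e => \sum_(e' | edge_map f e' == e) a e'.

Definition xi (R : realType) (S : cover_seq) (k n : nat) :
  edge_weight R (S (k + n)%N) -> edge_weight R (S n) := push (cs_proj S k n).

Definition delta_infty (R : realType) (S : cover_seq) :
    set (forall n, edge_weight R (S n)) :=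
  [set y | (forall n, @simplex R (S n) (y n)) /\
           (forall k n, (0 < k)%N -> xi (y (k + n)%N) = y n)].

Definition bar_measure (R : realType) (S : cover_seq)
    (mu : probability (borel_invlim S) R) (n : nat) : edge_weight R (S n) :=
  fun e => fine (mu (cylinder_edge e)).
Arguments bar_measure {R S} mu n.

(* lim_{n -> oo, n in N} x_n = y, where n = k + m in the condition at m. *)
Definition is_limit (R : realType) (S : cover_seq) (N : set nat)
    (x y : forall n, edge_weight R (S n)) : Prop :=
  delta_infty y /\
  forall m, (xi (x (k + m)%N) : edge_weight R (S m))
              @[k --> within [set k | N (k + m)%N] \oo] --> y m.

(* The edges of the closed walk (v_0, ..., v_l) with v_l = v_0, where
   s = [:: v_0; ...; v_(l-1)] is duplicate-free. *)
Definition walk_edges (G : graph) (s : seq G) : {set edges G} :=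
  finset (fun e : edges G => (src e \in s) && (next s (src e) == tgt e)).

(* Every vertex of a circuit has an edge of the circuit, so that the subgraph
   is determined by its edge set. *)
Definition circuit (G : graph) : set {set edges G} :=
  [set c | exists s : seq G,
     [/\ s != [::], ucycle edge s & c = walk_edges s]].

(* The number of edges of a circuit is its length, see period_walk_edges. *)
Definition period (G : graph) (c : {set edges G}) : nat := #|c|.

Lemma period_walk_edges (G : graph) (s : seq G) :
  ucycle edge s -> period (walk_edges s) = size s.
Proof.
case/andP=> cs us; rewrite /period -(card_uniqP us).
have src_inj : {in walk_edges s &, injective (@src G)}.
  move=> e e'; rewrite !inE => /andP[_ /eqP h] /andP[_ /eqP h'] ee'.
  apply: val_inj; apply: injective_projections => //.
  by move: h h'; rewrite /src /tgt in ee' * => <- <-; rewrite ee'.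
rewrite -(card_in_imset src_inj); apply: eq_card => v.
apply/imsetP/idP => [[e + ->]|vs]; first by rewrite inE => /andP[].
exists (exist _ (v, next s v) (next_cycle cs vs)) => //.
by rewrite inE vs /= eqxx.
Qed.

Definition tilde (R : realType) (G : graph) (c : {set edges G}) : edge_weight R G :=
  fun e => (period c)%:R^-1 * (e \in c)%:R.

(* A system enumerated by N is a sequence of which only the terms of index in
   N are relevant. *)
Definition circuit_system (S : cover_seq) (N : set nat)
    (C : forall n, {set {set edges (S n)}}) : Prop :=
  forall n, N n -> forall c, c \in C n -> circuit c.

Definition expresses (R : realType) (S : cover_seq) (N : set nat)
    (C : forall n, {set {set edges (S n)}})
    (mu : probability (borel_invlim S) R) : Prop :=
  forall n, N n -> exists s : {set edges (S n)} -> R,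
    (forall c, c \in C n -> 0 <= s c) /\
    (forall e, bar_measure mu n e = \sum_(c in C n) s c * tilde R c e).

(* The set \overline{C}_oo; the sequences c range over C_oo, the existence of the
   limit being part of is_limit. *)
Definition limits_of_system (R : realType) (S : cover_seq) (N : set nat)
    (C : forall n, {set {set edges (S n)}}) : set (forall n, edge_weight R (S n)) :=
  [set y | exists c : forall n, {set edges (S n)},
     (forall n, N n -> c n \in C n) /\
     is_limit N (fun n => tilde R (c n)) y].

(* Main.v *)
Require Import Defs.
From mathcomp Require Import all_boot all_order all_algebra.
From mathcomp Require Import all_classical all_reals all_analysis.
From mathcomp Require Import measurable_realfun lra.

(** An ergodic measure has no nontrivial decomposition into invariant measures,
    so when mu_n is written as a convex combination of circuit averages, most
    circuits, in the sense of the weights, must look like mu on any fixed level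
    m once n is large.  The proof makes this quantitative without extreme points
    or compactness of the space of measures.

    Fix an edge e of G_m, let A = U(e) and alpha = mu(A).  Ergodicity enters
    only through [overvisits_rare]: for b > alpha and eps > 0 there is a length
    K > 0 such that, outside a set of measure at most eps, an orbit segment of
    length K visits A at most b K times.  This is one half of the ergodic
    theorem, in measure; it follows from the maximal ergodic inequality
    [maximal_inequality] and a 0-1 law for the points with unbounded excess.

    Covers make G_n deterministic when observed at lower levels: the n-th
    coordinate of x determines the i-th coordinate of f^j x as soon as
    i + j <= n, and any walk in G_n through x_n computes it ([shadowing]).
    Hence, for n >= m + K, the number of visits to A in K steps is a function of
    the vertex x_n, and its mean over a circuit c of G_n is K times the frequency
    D(c) with which c passes over e ([visits_circuit]).  It follows that D(c)
    exceeds b by at most the proportion of bad edges of c, those from which A is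
    visited more than b K times ([circuit_density]).  Averaged over the
    circuits of C_n with the weights s(c), the proportion of bad edges is the
    measure of a bad set, at most eps.  So the average of the positive part of
    D(c) - alpha is small; as the average of D(c) is exactly alpha, the average
    of |D(c) - alpha| is small too ([average_deviation_edge]).

    Summing over the finitely many edges of the levels below r, some circuit of
    C_n is close to mu on all these levels, for all large n in N, and a diagonal
    choice over r gives one sequence of circuits that converges to mu. *)

Set Implicit Arguments.
Unset Strict Implicit.
Unset Printing Implicit Defensive.

Import Order.TTheory GRing.Theory Num.Theory.
Import numFieldNormedType.Exports.

Local Open Scope classical_set_scope.
Local Open Scope ring_scope.

(** * Overvisits in an ergodic system *)

Section Overvisits.
Context {d : measure_display} {T : measurableType d} {R : realType}.
Variables (P : probability T R) (f : T -> T).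
Hypothesis mf : measurable_fun setT f.
Hypothesis f_inv : forall A, measurable A -> P (f @^-1` A) = P A.
Hypothesis f_erg : forall A, measurable A -> f @^-1` A = A ->
  P A = 0%E \/ P A = 1%E.
Variable A : set T.
Hypothesis mA : measurable A.

Definition visits (K : nat) (x : T) : R := \sum_(k < K) \1_A (iter k f x).

Lemma visitsS K x : visits K.+1 x = \1_A x + visits K (f x).
Proof.
by rewrite /visits big_ord_recl; congr (_ + _); apply: eq_bigr => i _; rewrite -iterSr.
Qed.

Lemma measurable_iter k : measurable_fun setT (iter k f).
Proof.
elim: k => [|k IH]; first exact: measurable_id.
exact: (measurableT_comp mf IH).
Qed.

Lemma measurable_overvisits c K : measurable [set x | c < visits K x].
Proof.
rewrite -[X in measurable X]setTI.
rewrite (_ : [set x | _] = visits K @^-1` `]c, +oo[%classic); last first.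
  by apply/seteqP; split => x /=; rewrite in_itv /= andbT.
have mv : measurable_fun setT (visits K).
  apply: measurable_sum => k; apply: measurableT_comp (measurable_iter k).
  exact: measurable_indic.
by apply: mv => //; exact: measurable_itv.
Qed.

(** The largest of the sums [visits k x - a * k] over [k <= K].  The recursion
    in [f x] is the form in which the maximal inequality uses this maximum. *)
Fixpoint excess (a : R) (K : nat) (x : T) : R :=
  if K is K'.+1 then Num.max 0 (\1_A x - a + excess a K' (f x)) else 0.

Lemma indic01 (x : T) : 0 <= (\1_A x : R) <= 1.
Proof. by rewrite indicE; case: (_ \in _); rewrite ?lexx ?ler01. Qed.

Lemma excess_ge0 a K x : 0 <= excess a K x.
Proof. by case: K => [|K] //=; rewrite le_max lexx. Qed.

Lemma visits_le K x : visits K x <= K%:R.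
Proof.
rewrite /visits -[K in leRHS]card_ord -sumr_const; apply: ler_sum => k _.
by have /andP[] := indic01 (iter k f x).
Qed.

Lemma visits_le_excess a K x : visits K x - a * K%:R <= excess a K x.
Proof.
elim: K x => [|K IH] x; first by rewrite /visits big_ord0 mulr0 subr0.
rewrite visitsS /= le_max; apply/orP; right.
by have := IH (f x); rewrite -natr1; lra.
Qed.

Lemma excess_nd a x : {homo (fun K => excess a K x) : K L / (K <= L)%N >-> K <= L}.
Proof.
apply: (homo_leq (@lexx _ _) le_trans) => K.
elim: K x => [|K IH] x; first exact: excess_ge0.
rewrite [leRHS]/= [leLHS]/= ge_max le_max lexx /= le_max; apply/orP; right.
by rewrite lerD2l.
Qed.

Lemma excess_le a K x : 0 <= a -> excess a K x <= K%:R.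
Proof.
move=> a0; elim: K x => [|K IH] x //=.
rewrite ge_max ler0n /= -natr1.
by have := IH (f x); have /andP[] := indic01 x; lra.
Qed.

Lemma measurable_excess a K : measurable_fun setT (excess a K).
Proof.
elim: K => [|K IH] /=; first exact: measurable_cst.
apply: measurable_maxr; first exact: measurable_cst.
apply: measurable_funD; last exact: measurableT_comp.
by apply: measurable_funB => //; exact: measurable_indic.
Qed.

Let over a j : set T := \bigcup_K [set x | j < excess a K x].

Let measurable_level a j K : measurable [set x | j < excess a K x].
Proof.
rewrite -[X in measurable X]setTI.
rewrite (_ : [set x | _] = excess a K @^-1` `]j, +oo[%classic); last first.
  by apply/seteqP; split => x /=; rewrite in_itv /= andbT.
by apply: measurable_excess => //; exact: measurable_itv.
Qed.

(** One step of [f] changes the excess by a bounded amount, so whether it is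
    bounded depends on the orbit only: a shift of the bound [j] absorbs
    the change. *)
Lemma excess_invariant (a : R) : 0 <= a ->
  f @^-1` (\bigcap_j over a j%:R) = \bigcap_j over a j%:R.
Proof.
move=> a0; apply/seteqP; split => x /= B j _.
  have [K _ /= h] := B (j + Num.bound a)%N I; exists K.+1 => //=.
  rewrite lt_max; apply/orP; right; rewrite natrD in h.
  by have /andP[] := indic01 x; have := archi_boundP a0; lra.
have [[|K] _ /=] := B j.+1 I; first by rewrite ltNge ler0n.
rewrite lt_max [_ < 0]ltNge ler0n /= => h; exists K => //=; rewrite -natr1 in h.
by have /andP[] := indic01 x; lra.
Qed.

(** Where the excess is positive it is attained by a nonempty segment, so it is
    at most the first increment [\1_A x - a] plus the excess at [f x]; elsewhere
    it vanishes, and the term [a] makes up for the increment. *)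
Lemma excess_drift (a : R) K x : 0 <= a ->
  excess a K x + a <= \1_A x + a * (excess a K x <= 0)%R%:R + excess a K (f x).
Proof.
move=> a0; have /andP[i0 i1] := indic01 x; have e0 := excess_ge0 a K (f x).
have [le0|gt0] := leP (excess a K x) 0; first by rewrite mulr1; lra.
case: K gt0 {e0} => [|K]; first by rewrite ltxx.
rewrite [excess a K.+1 x]/= => gt0.
have := @excess_nd a (f x) K K.+1 (leqnSn _).
move: gt0; rewrite lt_max ltxx /= => gt0; rewrite (max_r (ltW gt0)).
lra.
Qed.

Lemma integral_comp_invariant (g : T -> \bar R) : measurable_fun setT g ->
  (forall x, 0 <= g x)%E -> (\int[P]_x g (f x) = \int[P]_x g x)%E.
Proof.
move=> mg g0; rewrite -[LHS]/(integral P (f @^-1` setT) (g \o f)).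
rewrite -(ge0_integral_pushforward mf) //.
by apply: eq_measure_integral => B mB _; exact: f_inv.
Qed.

(** Integrating [excess_drift], the integrals of the excess at [x] and at [f x]
    are equal and finite and so cancel. *)
Lemma maximal_inequality (a : R) K : 0 <= a ->
  (a%:E <= P A + a%:E * P [set x | (excess a K x <= 0)%R])%E.
Proof.
move=> a0; set Z := [set x | _].
have mZ : measurable Z.
  rewrite (_ : Z = ~` [set x | 0 < excess a K x]).
    by apply: measurableC; exact: measurable_level.
  by apply/seteqP; rewrite /Z; split => x /=; rewrite leNgt => /negP.
have mE L : measurable_fun setT (fun x => (excess a L x)%:E).
  exact/measurable_EFinP/measurable_excess.
have E0 L x : (0 <= (excess a L x)%:E)%E by rewrite lee_fin excess_ge0.
have mI (B : set T) : measurable B -> measurable_fun setT (fun x => (\1_B x : R)%:E).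
  by move=> mB; apply/measurable_EFinP; exact: measurable_indic.
have I0 (B : set T) x : (0 <= (\1_B x : R)%:E)%E by rewrite lee_fin indicE.
have fin : (\int[P]_x (excess a K x)%:E)%E \is a fin_num.
  rewrite ge0_fin_numE; last exact: integral_ge0.
  apply: (@le_lt_trans _ _ (\int[P]_x (K%:R : R)%:E)%E).
    apply: ge0_le_integral => //.
    by move=> x _; rewrite lee_fin excess_le.
  by rewrite integral_cst // [X in (_ * X)%E]probability_setT mule1 ltry.
have pointwise x : ((excess a K x)%:E + a%:E <=
    ((\1_A x : R)%:E + a%:E * (\1_Z x : R)%:E) + (excess a K (f x))%:E)%E.
  rewrite -!(EFinD, EFinM) lee_fin [\1_Z x]indicE (_ : (x \in Z) = (excess a K x <= 0)).
    exact: excess_drift.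
  by apply/idP/idP => [/set_mem|/mem_set].
have : (\int[P]_x ((excess a K x)%:E + a%:E) <= \int[P]_x
    (((\1_A x : R)%:E + a%:E * (\1_Z x : R)%:E) + (excess a K (f x))%:E))%E.
  apply: ge0_le_integral => //.
  - by move=> x _; rewrite adde_ge0.
  - exact: emeasurable_funD.
  - apply: emeasurable_funD; last exact: measurableT_comp (mE K) mf.
    by apply: emeasurable_funD; [exact: mI|apply: measurable_funeM; exact: mI].
rewrite ge0_integralD // integral_cst // [X in (_ * X)%E]probability_setT mule1.
rewrite ge0_integralD //; first last.
- exact: measurableT_comp (mE K) mf.
- by apply: emeasurable_funD; [exact: mI|apply: measurable_funeM; exact: mI].
- by move=> x _; rewrite adde_ge0 // mule_ge0.
rewrite (integral_comp_invariant (mE K)) // addeC leeD2rE //.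
rewrite ge0_integralD //; first last.
- by apply: measurable_funeM; exact: mI.
- by move=> x _; rewrite mule_ge0.
- exact: mI.
rewrite ge0_integralZl //; last exact: mI.
by rewrite !integral_indic // !setIT.
Qed.

Let measurable_over a j : measurable (over a j).
Proof. by apply: bigcup_measurable => K _; exact: measurable_level. Qed.

(** If the excess were unbounded almost everywhere, the sets where it vanishes
    would have measure tending to 0, while the maximal inequality bounds their
    measure below by [1 - P A / a > 0]. *)
Lemma excess_bounded_ae (a : R) : fine (P A) < a ->
  P (\bigcap_j over a j%:R) = 0%E.
Proof.
move=> Aa; have A0 : 0 <= fine (P A) by rewrite fine_ge0.
have a0 : 0 < a by exact: le_lt_trans Aa.
have mB : measurable (\bigcap_j over a j%:R).
  by apply: bigcap_measurable => // j _; exact: measurable_over.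
have [//|PB] := f_erg mB (excess_invariant (ltW a0)).
(* The complement of the vanishing set, uniformly in [K]. *)
have le_level K : (P [set x | (0 < excess a K x)%R] <= (fine (P A) / a)%:E)%E.
  rewrite (_ : [set x | _] = ~` [set x | excess a K x <= 0]); last first.
    by apply/seteqP; split => x /=; rewrite ltNge => /negP.
  have mZ : measurable [set x | excess a K x <= 0].
    rewrite (_ : [set x | _] = ~` [set x | 0 < excess a K x]).
      by apply: measurableC; exact: measurable_level.
    by apply/seteqP; split => x /=; rewrite leNgt => /negP.
  rewrite probability_setC //.
  have := maximal_inequality K (ltW a0).
  rewrite -(fineK (fin_num_measure P _ mA)) -(fineK (fin_num_measure P _ mZ)).
  rewrite -EFinB -EFinM -EFinD !lee_fin ler_pdivlMr //= => h.
  by rewrite mulrBl mul1r [_ * a]mulrC; lra.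
have cv := @nondecreasing_cvg_mu _ _ _ P (fun K => [set x | 0 < excess a K x])
  (measurable_level a 0) (measurable_over a 0).
have {}cv : (P \o (fun K => [set x | 0 < excess a K x])) @ \oo --> P (over a 0).
  apply: cv => K L KL; apply/subsetPset => x /= h.
  exact: lt_le_trans h (excess_nd _ _ KL).
have : (P (over a 0%R) <= (fine (P A) / a)%:E)%E.
  rewrite -(cvg_lim _ cv) //; apply: lime_le; first exact: cvgP cv.
  by near=> K; exact: le_level.
have : (P (\bigcap_j over a j%:R) <= P (over a 0%R))%E.
  by apply: le_measure; rewrite ?inE // => x /(_ 0%N I).
rewrite PB => /le_trans /[apply]; rewrite lee_fin ler_pdivlMr // mul1r.
by rewrite leNgt Aa.
Unshelve. all: by end_near. Qed.

(** With [a] strictly between [P A] and [b], a segment of length [K] with more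
    than [b * K] visits has excess more than [(b - a) * K], which is a rare event
    for large [K] as the excess is bounded almost everywhere. *)
Lemma overvisits_rare (b e : R) : fine (P A) < b -> 0 < e ->
  exists2 K, (0 < K)%N & (P [set x | (b * K%:R < visits K x)%R] <= e%:E)%E.
Proof.
move=> Ab e0; pose a := (fine (P A) + b) / 2.
have Aa : fine (P A) < a by rewrite /a; lra.
have ab : 0 < b - a by rewrite /a; lra.
have [j Pj] : exists j, (P (over a j%:R) <= e%:E)%E.
  apply: contrapT => /forallNP no.
  have cv : (P \o (fun j => over a j%:R)) @ \oo --> P (\bigcap_j over a j%:R).
    apply: nonincreasing_cvg_mu.
    - by rewrite (le_lt_trans (probability_le1 _ _)) ?ltry.
    - by move=> j; exact: measurable_over.
    - by apply: bigcap_measurable => // j _; exact: measurable_over.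
    - move=> i j ij; apply/subsetPset => x [K _ /= h]; exists K => //=.
      by rewrite (le_lt_trans _ h) // ler_nat.
  have : (e%:E <= P (\bigcap_j over a j%:R))%E.
    rewrite -(cvg_lim _ cv) //; apply: lime_ge; first exact: cvgP cv.
    by near=> j; apply: ltW; rewrite ltNge; apply/negP/no.
  by rewrite excess_bounded_ae // lee_fin leNgt e0.
exists (Num.bound (j%:R / (b - a))).+1 => //.
set K := _.+1; apply: le_trans Pj.
have jK : j%:R <= (b - a) * K%:R.
  rewrite mulrC -ler_pdivrMr // ltW // (lt_le_trans (archi_boundP _)) //.
    by rewrite divr_ge0 // ltW.
  by rewrite ler_nat /K.
have sub : [set x | b * K%:R < visits K x] `<=` over a j%:R.
  move=> x /= h; exists K => //=; apply: lt_le_trans (visits_le_excess a K x).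
  by rewrite ltrBrDr; apply: le_lt_trans h; rewrite -lerBrDr -mulrBl.
apply: le_measure => //; rewrite inE; last exact: measurable_over.
exact: measurable_overvisits.
Unshelve. all: by end_near. Qed.
End Overvisits.

(** * Threads and shadowing *)

(** By induction on [n], dropping the first term of the inverse system, so that
    only the case [n = 0] involves a choice. *)
Lemma thread_extension (V : nat -> Type) (g : forall n, V n.+1 -> V n) :
  (forall n v, exists u, g n u = v) ->
  forall n (v : V n), exists x : forall i, V i, x n = v /\ forall i, x i = g i (x i.+1).
Proof.
move=> gsurj n; elim: n V g gsurj => [|n IH] V g gsurj v.
  have lift i w : {u | g i u = w} by apply/cid/gsurj.
  pose x := fix x i : V i := if i is i'.+1 then sval (lift i' (x i')) else v.
  by exists x; split => // i; rewrite /= (svalP (lift i (x i))).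
have [x [xn xg]] := IH (fun i => V i.+1) (fun i => g i.+1) (fun i => gsurj i.+1) v.
pose y i : V i := if i is i'.+1 then x i' else g 0%N (x 0%N).
by exists y; split => // -[|i].
Qed.

Section Threads.
Variable S : cover_seq.
Local Notation f := (@invlim_map S).

Lemma thread_exists n (v : S n) : exists x : invlim S, thread_coord x n = v.
Proof.
have [x [xn xS]] : exists x : forall i, S i,
    x n = v /\ forall i, x i = cs_map S i (x i.+1).
  apply: (@thread_extension (fun i => S i) (fun i => cs_map S i)) => i w.
  by have [u /eqP] := cs_map_surj w; exists u.
by exists (exist _ (x : prod_topology _) (mem_set (xS : threads S x))).
Qed.

(** A thread through each vertex reads off the image of a vertex of G_n in G_m
    without writing n as k + m. *)
Definition through n (v : S n) : invlim S := sval (cid (thread_exists v)).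

Lemma throughK n (v : S n) : thread_coord (through v) n = v.
Proof. exact: svalP (cid (thread_exists v)). Qed.

Lemma thread_coord_le (x y : invlim S) i n : (i <= n)%N ->
  thread_coord x n = thread_coord y n -> thread_coord x i = thread_coord y i.
Proof.
move=> /subnK <-; elim: (n - i)%N => [//|k IH] xy.
by apply: IH; rewrite !(thread_coordE _ (k + i)) xy.
Qed.

Lemma edge_coord_le (x y : invlim S) i n : (i <= n)%N ->
  edge (thread_coord x n) (thread_coord y n) ->
  edge (thread_coord x i) (thread_coord y i).
Proof.
move=> /subnK <-; elim: (n - i)%N => [//|k IH] xy.
by apply: IH; rewrite !(thread_coordE _ (k + i)); exact: ghom_edge.
Qed.

(** A cover maps all successors of a vertex to the same vertex, so at any lower
    level every successor of [x] agrees with [f x]. *)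
Lemma thread_coord_succ (x y : invlim S) i n : (i < n)%N ->
  edge (thread_coord x n) (thread_coord y n) ->
  thread_coord (f x) i = thread_coord y i.
Proof.
move=> lt_in /(edge_coord_le lt_in) xy; rewrite thread_coordE [RHS]thread_coordE.
apply: (cs_cover S i).2 _ xy.
by have /invlim_mapP := erefl (f x).
Qed.

(** A sequence of threads whose n-th coordinates form a walk is a pseudo-orbit;
    each step costs one level of agreement with the true orbit. *)
Lemma shadowing (x : nat -> invlim S) (y : invlim S) n :
  thread_coord y n = thread_coord (x 0%N) n ->
  (forall j, edge (thread_coord (x j) n) (thread_coord (x j.+1) n)) ->
  forall j i, (i + j <= n)%N ->
    thread_coord (iter j f y) i = thread_coord (x j) i.
Proof.
move=> yx xx; elim=> [|j IH] i ijn.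
  by apply: thread_coord_le yx; rewrite addn0 in ijn.
rewrite iterS addnS -addSn in ijn *.
have lt_in : (i < n)%N by exact: leq_trans (leq_addr _ _) ijn.
apply: (@thread_coord_succ _ _ _ i.+1) => //; rewrite IH //.
exact: edge_coord_le (xx j).
Qed.

Definition thread_edge (x : invlim S) n : edges (S n) :=
  exist _ (thread_coord x n, thread_coord (f x) n)
    (((invlim_mapP x (f x)).1 erefl) n).

Lemma cylinder_edgeE n (e : edges (S n)) :
  cylinder_edge e = [set x | thread_edge x n = e].
Proof.
apply/seteqP; split => x /=; last by move=> <-; split.
move=> [xs xt]; apply: val_inj; rewrite [val e]surjective_pairing.
by congr pair.
Qed.

(** The target at level m is determined one level higher, hence [m < n]. *)
Lemma thread_edge_lt (x y : invlim S) m n : (m < n)%N ->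
  thread_coord x n = thread_coord y n -> thread_edge x m = thread_edge y m.
Proof.
move=> mn xy; apply: val_inj; congr pair; first exact: thread_coord_le (ltnW mn) xy.
apply: (thread_coord_succ mn); rewrite xy.
exact: (((invlim_mapP y (f y)).1 erefl) n).
Qed.

Lemma shadowing_edge (x : nat -> invlim S) (y : invlim S) n :
  thread_coord y n = thread_coord (x 0%N) n ->
  (forall j, edge (thread_coord (x j) n) (thread_coord (x j.+1) n)) ->
  forall j m, (m + j < n)%N -> thread_edge (iter j f y) m = thread_edge (x j) m.
Proof.
move=> yx xx j m mjn; apply: (thread_edge_lt (ltnSn m)).
by apply: shadowing yx xx _ _ _; rewrite addSn.
Qed.

Lemma cs_proj_coord k m (x : invlim S) :
  cs_proj S k m (thread_coord x (k + m)%N) = thread_coord x m.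
Proof. by elim: k => [//|k IH]; rewrite -[RHS]IH /= -thread_coordE. Qed.

Lemma edge_map_thread k m (x : invlim S) :
  edge_map (cs_proj S k m) (thread_edge x (k + m)%N) = thread_edge x m.
Proof. by apply: val_inj; congr pair; exact: cs_proj_coord. Qed.

(** For k > 0 the image of an edge is determined by its source alone. *)
Lemma edge_map_through k m (e : edges (S (k + m)%N)) : (0 < k)%N ->
  edge_map (cs_proj S k m) e = thread_edge (through (src e)) m.
Proof.
move=> k0; have mk : (m < k + m)%N by rewrite -[X in (X < _)%N]add0n ltn_add2r.
apply: val_inj; congr pair.
  by rewrite -[src e in LHS]throughK cs_proj_coord.
rewrite -[tgt e]throughK cs_proj_coord; apply/esym/(thread_coord_succ mk).
rewrite !throughK; exact: valP e.
Qed.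

Lemma open_cylinder n (v : S n) : open (cylinder_vertex v).
Proof.
exists (@proj _ (fun n => discrete_topology (S n)) n @^-1` [set v]) => //.
apply: (continuousP _).1; first exact: proj_continuous.
exact: discrete_open.
Qed.

Lemma invlim_map_continuous : continuous (f : invlim S -> invlim S).
Proof.
move=> x A [B [[C oC <-] Cfx] CA].
have : nbhs x ((fun y => val (f y)) @^-1` C).
  suff /(_ C) : (fun y => val (f y)) @ x -->
      (val (f x) : prod_topology (fun n => discrete_topology (S n))).
    by apply; apply: open_nbhs_nbhs.
  have FF : Filter ((fun y => val (f y)) @ x) by apply: fmap_filter; exact: nbhs_filter.
  apply/cvg_sup => i U [V [[W oW <-] Wfx] WU].
  apply: (@filterS _ _ _ (cylinder_vertex (thread_coord x i.+1))).
    move=> y yx; apply: WU; change (W (val (f y) i)).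
    rewrite (_ : val (f y) i = val (f x) i) //.
    by have := congr1 (@tgt (S i)) (thread_edge_lt (ltnSn i) yx).
  by apply: open_nbhs_nbhs; split => //; exact: open_cylinder.
by apply: filterS => y Cy; exact: CA.
Qed.

Lemma measurable_invlim_map :
  measurable_fun setT (f : borel_invlim S -> borel_invlim S).
Proof.
apply: (@measurability _ _ (borel_invlim S) (borel_invlim S) setT f
  (@open (invlim S))) => //.
move=> _ [U oU <-]; rewrite setTI; apply: sub_sigma_algebra.
exact: (continuousP _).1 invlim_map_continuous _ oU.
Qed.

Lemma thread_edge_bigcup n (p : pred (edges (S n))) :
  [set x | p (thread_edge x n)] = \bigcup_(e in [set` enum p]) cylinder_edge e.
Proof.
apply/seteqP; split => x /= => [px|[e]].
  by exists (thread_edge x n); rewrite /= ?mem_enum // cylinder_edgeE.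
by rewrite cylinder_edgeE /= mem_enum => pe ->.
Qed.

Lemma measurable_cylinder_edge n (e : edges (S n)) :
  measurable (cylinder_edge e : set (borel_invlim S)).
Proof.
apply: measurableI; first by apply: sub_sigma_algebra; exact: open_cylinder.
rewrite -[X in measurable X]setTI; apply: measurable_invlim_map => //.
by apply: sub_sigma_algebra; exact: open_cylinder.
Qed.

Lemma measurable_thread_edge n (p : pred (edges (S n))) :
  measurable ([set x | p (thread_edge x n)] : set (borel_invlim S)).
Proof.
rewrite thread_edge_bigcup; apply: fin_bigcup_measurable => //.
by move=> e _; exact: measurable_cylinder_edge.
Qed.
End Threads.

(** * The weights of an invariant measure *)

Section BarMeasure.
Variables (R : realType) (S : cover_seq) (mu : probability (borel_invlim S) R).

(** Every identity between sums of the weights mu_n(e) is an identity between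
    measures of sets described by the pair of coordinates (x_n, f(x)_n). *)
Lemma sum_bar_measure n (p : pred (edges (S n))) :
  \sum_(e | p e) bar_measure mu n e = fine (mu [set x | p (thread_edge x n)]).
Proof.
apply: EFin_inj; rewrite -sumEFin fineK; last first.
  exact: (fin_num_measure mu _ (measurable_thread_edge p)).
rewrite thread_edge_bigcup measure_fin_bigcup //; first last.
- move=> e _; exact: measurable_cylinder_edge e.
- by move=> e e' _ _ [x []]; rewrite !cylinder_edgeE /= => -> ->.
rewrite -fsbig_seq ?enum_uniq // big_enum_cond /=.
apply: eq_big => [e|e _]; first by rewrite andbT.
by rewrite fineK // (fin_num_measure mu _ (measurable_cylinder_edge e)).
Qed.

Lemma bar_measure_ge0 n e : 0 <= bar_measure mu n e.
Proof. exact: fine_ge0. Qed.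

Lemma bar_measure_sum1 n : \sum_e bar_measure mu n e = 1.
Proof.
rewrite sum_bar_measure (_ : [set x | _] = setT) ?probability_setT //.
by apply/seteqP; split.
Qed.

Lemma xi_bar_measure k m : xi (bar_measure mu (k + m)) = bar_measure mu m.
Proof.
apply/funext => e; rewrite /xi /push sum_bar_measure; congr (fine (mu _)).
rewrite cylinder_edgeE; apply/seteqP.
by split => x /=; rewrite edge_map_thread => /eqP.
Qed.

Lemma bar_measure_delta : invariant_measure mu -> delta_infty (bar_measure mu).
Proof.
move=> muf; split=> [n|k n _]; last exact: xi_bar_measure.
split; [exact: bar_measure_ge0|exact: bar_measure_sum1|move=> v].
rewrite !sum_bar_measure; congr fine.
have := muf _ (measurable_thread_edge (fun e : edges (S n) => src e == v)).
by move=> <-.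
Qed.
End BarMeasure.

(** * Averages over circuits *)

Section CircuitRotation.
Variables (G : graph) (c : {set edges G}).
Hypothesis circ : circuit c.

Lemma circuit_card_gt0 : (0 < #|c|)%N.
Proof.
have [s [s0 cs ->]] := circ; rewrite -/(period _) period_walk_edges //.
by rewrite lt0n size_eq0.
Qed.

(** Passing from each edge to the next one shifts a sum over a circuit by one
    step, without reference to the list of its vertices. *)
Lemma circuit_rotation : exists sigma : edges G -> edges G,
  [/\ forall e, e \in c -> sigma e \in c,
      forall e, e \in c -> src (sigma e) = tgt e &
      {in c &, injective sigma}].
Proof.
have [s [s0 /andP[cs us] defc]] := circ.
have cE e : (e \in c) = (src e \in s) && (next s (src e) == tgt e).
  by rewrite defc inE.
have succ e : exists e', e \in c -> e' \in c /\ src e' = tgt e.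
  case: (boolP (e \in c)) => [ec|_]; last by exists e.
  have ts : tgt e \in s by move: ec; rewrite cE => /andP[es /eqP <-]; rewrite mem_next.
  exists (exist _ (tgt e, next s (tgt e)) (next_cycle cs ts)) => _.
  by rewrite cE /src /tgt /= ts eqxx.
pose sigma e := sval (cid (succ e)).
have sigmaP e : e \in c -> sigma e \in c /\ src (sigma e) = tgt e.
  exact: svalP (cid (succ e)).
exists sigma; split=> [e /sigmaP[]|e /sigmaP[]|] //.
move=> e e' ec e'c /(congr1 (@src G)).
rewrite (sigmaP e ec).2 (sigmaP e' e'c).2 => ee'.
apply: val_inj; apply: injective_projections; last exact: ee'.
move: ec e'c; rewrite !cE => /andP[_ /eqP h] /andP[_ /eqP h'].
by apply: (can_inj (prev_next us)); rewrite [LHS]h [RHS]h'.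
Qed.

(** The rotation permutes the edges of the circuit. *)
Lemma sum_iter_rotation (R : realType) (sigma : edges G -> edges G)
    (g : edges G -> R) k :
  (forall e, e \in c -> sigma e \in c) -> {in c &, injective sigma} ->
  \sum_(e in c) g (iter k sigma e) = \sum_(e in c) g e.
Proof.
move=> sc sinj; elim: k g => [//|k IH] g.
rewrite -(IH g); have {2}<- : sigma @: c = c.
  apply/eqP; rewrite eqEcard card_in_imset // leqnn andbT.
  by apply/fintype.subsetP => _ /imsetP[e ec ->]; exact: sc.
by rewrite big_imset //; apply: eq_bigr => e _; rewrite iterSr.
Qed.
End CircuitRotation.

Section CircuitWeights.
Variables (R : realType) (S : cover_seq).
Local Notation f := (@invlim_map S).
Local Notation visits_to e :=
  (visits (R := R) (f : borel_invlim S -> borel_invlim S) (cylinder_edge e)).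

(** The map xi_{n,m} for arbitrary n and m, free of casts; it is the intended map
    for m < n, by [xi_atE]. *)
Definition xi_at n m (a : edge_weight R (S n)) : edge_weight R (S m) :=
  fun e => \sum_(e' | thread_edge (through (src e')) m == e) a e'.

Arguments xi_at {n} m a.

Lemma xi_atE k m (a : edge_weight R (S (k + m)%N)) : (0 < k)%N ->
  xi a = xi_at m a.
Proof.
move=> k0; apply/funext => e; rewrite /xi /push /xi_at.
by apply: eq_bigl => e'; rewrite edge_map_through.
Qed.

Lemma sum_tilde (G : graph) (c : {set edges G}) (p : pred (edges G)) :
  \sum_(e | p e) tilde R c e = (period c)%:R^-1 * \sum_(e in c) (p e)%:R.
Proof.
rewrite /tilde -mulr_sumr; congr (_ * _).
rewrite big_mkcond [RHS]big_mkcond; apply: eq_bigr => e _.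
by case: (p e); case: (e \in c).
Qed.

Lemma sum_tilde1 (G : graph) (c : {set edges G}) : circuit c ->
  \sum_e tilde R c e = 1.
Proof.
move=> cc; rewrite sum_tilde sumr_const -[X in _ * X]/(#|c|%:R) mulVf //.
by rewrite pnatr_eq0 -lt0n; exact: circuit_card_gt0.
Qed.

(** Along a circuit the orbit of a thread is shadowed by the circuit itself, so
    the k-th visit starting from an edge is read at its k-th rotation, and summing
    over all starting edges removes the rotation. *)
Lemma visits_circuit n m K (e : edges (S m)) (c : {set edges (S n)}) :
  circuit c -> (m + K <= n)%N ->
  \sum_(e' in c) visits_to e K (through (src e'))
  = K%:R * \sum_(e' in c) (thread_edge (through (src e')) m == e)%:R.
Proof.
move=> cc mKn; have [sigma [sc sE sinj]] := circuit_rotation cc.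
have orbit k e' : e' \in c -> iter k sigma e' \in c.
  by move=> ec; elim: k => [//|k IH] /=; exact: sc.
have hit e' k : e' \in c -> (k < K)%N ->
    \1_(cylinder_edge e) (iter k f (through (src e'))) =
    (thread_edge (through (src (iter k sigma e'))) m == e)%:R :> R.
  move=> ec kK; rewrite indicE cylinder_edgeE.
  have -> : thread_edge (through (src (iter k sigma e'))) m =
      thread_edge (iter k f (through (src e'))) m.
    apply/esym/(@shadowing_edge _ (fun j => through (src (iter j sigma e'))) _ n) => //.
      move=> j; rewrite !throughK iterS sE ?orbit //; exact: valP (iter j sigma e').
    by apply: leq_trans mKn; rewrite ltn_add2l.
  by congr (nat_of_bool _)%:R; apply/idP/eqP => [/set_mem|/mem_set].
rewrite exchange_big /=.
under eq_bigr => k _.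
  under eq_bigr => e' ec do rewrite hit //.
  rewrite (sum_iter_rotation
    (fun e' => (thread_edge (through (src e')) m == e)%:R : R)) //.
  over.
by rewrite sumr_const card_ord mulr_natl.
Qed.

(** A starting edge contributes at most [b * K] visits, or at most [K] if it is
    bad; divide [visits_circuit] by [K] and by the period. *)
Lemma circuit_density n m K (b : R) (e : edges (S m)) (c : {set edges (S n)}) :
  circuit c -> (0 < K)%N -> (m + K <= n)%N -> 0 <= b ->
  xi_at m (tilde R c) e <= b +
    \sum_(e' | b * K%:R < visits_to e K (through (src e'))) tilde R c e'.
Proof.
move=> cc K0 mKn b0; rewrite /xi_at !sum_tilde.
have N0 : 0 < (period c)%:R :> R by rewrite ltr0n; exact: circuit_card_gt0.
rewrite -(ler_pM2l N0) mulrDr !mulVKf ?gt_eqF //.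
have K0' : 0 < K%:R :> R by rewrite ltr0n.
rewrite -(ler_pM2l K0') -(visits_circuit e cc mKn).
have -> : (period c)%:R * b = \sum_(e' in c) b by rewrite sumr_const mulr_natl.
rewrite -big_split mulr_sumr /=.
apply: ler_sum => e' _; set v := visits _ _ _ _.
have vK : v <= K%:R by exact: visits_le.
have [h|h] := ltP; first by rewrite mulrDr mulr1 ler_wpDl // mulr_ge0 // ltW.
by rewrite addr0 mulrC.
Qed.
End CircuitWeights.
Arguments xi_at {R S n} m a.

(** * Convex combinations, diagonal choices and pointwise limits *)

Section Mixture.
Variables (R : realType) (I : finType) (C : {set I}) (s : I -> R).
Hypothesis s0 : forall c, c \in C -> 0 <= s c.
Hypothesis s1 : \sum_(c in C) s c = 1.

Lemma average_le (d : I -> R) eta : \sum_(c in C) s c * d c <= eta ->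
  exists2 c, c \in C & d c <= eta.
Proof.
move=> deta; apply: contrapT => no.
have dlt c : c \in C -> eta < d c.
  by move=> cC; rewrite ltNge; apply/negP => h; apply: no; exists c.
have nn c : c \in C -> 0 <= s c * (d c - eta).
  by move=> cC; rewrite mulr_ge0 ?s0 // subr_ge0 ltW ?dlt.
have sd : \sum_(c in C) s c * (d c - eta) = 0.
  apply/eqP; rewrite eq_le sumr_ge0 ?andbT //.
  under eq_bigr do rewrite mulrBr.
  by rewrite sumrB -mulr_suml s1 mul1r subr_le0.
have sz c : c \in C -> s c = 0.
  move=> cC; have /eqP := psumr_eq0P nn sd cC.
  by rewrite mulf_eq0 subr_eq0 (gt_eqF (dlt _ cC)) orbF => /eqP.
by move/eqP: s1; rewrite big1 // eq_sym oner_eq0.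
Qed.
End Mixture.

Lemma ptws_cvg (I T : Type) (V : topologicalType) (F : set_system T)
    (FF : Filter F) (u : T -> {ptws I -> V}) (l : {ptws I -> V}) :
  (forall i, u x i @[x --> F] --> l i) -> u @ F --> l.
Proof.
move=> ul; have uF : Filter (u @ F) by exact: fmap_filter.
apply/cvg_sup => i A [B [[W oW <-] Wl] BA].
by apply: filterS BA _; apply: (ul i); apply: open_nbhs_nbhs.
Qed.

(** At index [n], take a term good for the largest [r <= n] for which there is
    one. *)
Lemma diagonal_choice (T : nat -> Type) (N : set nat)
    (Q : forall n, nat -> T n -> Prop) :
  (forall n, T n) ->
  (forall n r r' c, (r <= r')%N -> Q n r' c -> Q n r c) ->
  (forall n, N n -> exists c, Q n 0%N c) ->
  (forall r, \forall n \near \oo, N n -> exists c, Q n r c) ->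
  exists c : forall n, T n, (forall n, N n -> Q n 0%N (c n)) /\
    forall r, \forall n \near \oo, N n -> Q n r (c n).
Proof.
move=> t0 Qnd Q0 Qev.
have best n : {c | N n -> forall r, (r <= n)%N -> (exists c', Q n r c') -> Q n r c}.
  apply: cid; have [Nn|nN] := pselect (N n); last by exists (t0 n).
  have ex0 : exists r, (r <= n)%N && `[< exists c, Q n r c >].
    by exists 0%N; apply/asboolP/Q0.
  have bound r : (r <= n)%N && `[< exists c, Q n r c >] -> (r <= n)%N by case/andP.
  case: (ex_maxnP ex0 bound) => r /andP[_ /asboolP[c Qc]] rmax.
  exists c => _ r' r'n ex; apply: Qnd Qc.
  by apply: rmax; rewrite r'n; exact/asboolP.
exists (fun n => sval (best n)); split=> [n Nn|r].
  by apply: (svalP (best n)) => //; exact: Q0.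
near=> n => Nn.
apply: (svalP (best n)) => //; first by near: n; exact: nbhs_infty_ge.
by apply: (near (Qev r) n).
Unshelve. all: by end_near. Qed.

(** * Convergence of the averages over the circuits *)

Section Deviation.
Variables (R : realType) (S : cover_seq) (mu : probability (borel_invlim S) R).
Hypothesis hmu : ergodic_measure mu.
Local Notation f := (@invlim_map S).
Local Notation bar := (bar_measure mu).
Local Notation visits_to e :=
  (visits (R := R) (f : borel_invlim S -> borel_invlim S) (cylinder_edge e)).

Lemma xi_at_bar n m e : (m < n)%N -> xi_at m (bar n) e = bar m e.
Proof.
move=> mn; rewrite /xi_at sum_bar_measure [RHS]/bar_measure cylinder_edgeE.
congr (fine (mu _)).
have E x : thread_edge (through (src (thread_edge x n))) m = thread_edge x m.
  by apply: (thread_edge_lt mn); rewrite throughK.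
by apply/seteqP; split => x /=; rewrite E => /eqP.
Qed.

Variables (N : set nat) (C : forall n, {set {set edges (S n)}}).
Hypothesis hC : circuit_system N C.
Variable s : forall n, {set edges (S n)} -> R.
Arguments s {n}.
Hypothesis s_ge0 : forall n c, N n -> c \in C n -> 0 <= s c.
Hypothesis sE : forall n e, N n -> bar n e = \sum_(c in C n) s c * tilde R c e.

Lemma mixture_sum n (p : pred (edges (S n))) : N n ->
  \sum_(c in C n) s c * (\sum_(e | p e) tilde R c e) = \sum_(e | p e) bar n e.
Proof.
move=> Nn; under eq_bigr do rewrite mulr_sumr.
by rewrite exchange_big; apply: eq_bigr => e _; rewrite sE.
Qed.

Lemma mixture_total n : N n -> \sum_(c in C n) s c = 1.
Proof.
move=> Nn; rewrite -(bar_measure_sum1 mu n) -mixture_sum //.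
by apply: eq_bigr => c cC; rewrite sum_tilde1 ?mulr1 //; exact: hC cC.
Qed.

(** The deviation D(c) - alpha has average 0, and it is at most the
    nonnegative quantity [eta / 4 + beta c], where [beta c] is the proportion of
    bad edges of [c], so
    [`|D c| <= 2 * (eta / 4 + beta c) - D c] for either sign of [D c]. *)
Lemma average_deviation_edge m (e : edges (S m)) (eta : R) : 0 < eta ->
  \forall n \near \oo, N n ->
    \sum_(c in C n) s c * `|xi_at m (tilde R c) e - bar m e| <= eta.
Proof.
move=> eta0; have [muf muerg] := hmu.
have eta4 : 0 < eta / 4 by rewrite divr_gt0.
set alpha := bar m e; pose b := alpha + eta / 4.
have [K K0 rare] : exists2 K, (0 < K)%N & (mu [set x |
    (b * K%:R < visits_to e K x)%R] <= (eta / 4)%:E)%E.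
  apply: overvisits_rare => //; first exact: measurable_invlim_map.
    exact: measurable_cylinder_edge.
  by rewrite ltrDl.
near=> n => Nn.
have mKn : (m + K <= n)%N by near: n; exact: nbhs_infty_ge.
have mn : (m < n)%N by rewrite (leq_trans _ mKn) // -addn1 leq_add2l.
pose bad (e' : edges (S n)) := b * K%:R < visits_to e K (through (src e')).
pose D (c : {set edges (S n)}) := xi_at m (tilde R c) e - alpha.
pose beta (c : {set edges (S n)}) := \sum_(e' | bad e') tilde R c e'.
have b0 : 0 <= b by rewrite addr_ge0 ?bar_measure_ge0 // ltW.
have le_beta : \sum_(c in C n) s c * beta c <= eta / 4.
  rewrite mixture_sum // sum_bar_measure -lee_fin fineK; last first.
    exact: (fin_num_measure mu _ (measurable_thread_edge bad)).
  apply: le_trans rare; apply: le_measure; rewrite ?inE.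
  - exact: measurable_thread_edge.
  - apply: measurable_overvisits; first exact: measurable_invlim_map.
    exact: (measurable_cylinder_edge e).
  move=> x; rewrite /= /bad; set v := visits _ _ _ _; set v' := visits _ _ _ _.
  (* As m + K <= n, the visits of x in K steps are determined by x_n. *)
  suff -> : v = v' by [].
  apply: eq_bigr => k _; rewrite !indicE !cylinder_edgeE.
  have E : thread_edge (iter k f (through (src (thread_edge x n)))) m =
      thread_edge (iter k f x) m.
    apply: (@shadowing_edge _ (fun j => iter j f x) _ n); first by rewrite throughK.
      by move=> j; exact: valP (thread_edge (iter j f x) n).
    by apply: leq_trans mKn; rewrite ltn_add2l.
  congr (nat_of_bool _)%:R.
  by apply/idP/idP => /set_mem /= h; apply/mem_set => /=; rewrite -h E.
have D0 : \sum_(c in C n) s c * D c = 0.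
  rewrite /D; under eq_bigr do rewrite mulrBr.
  rewrite sumrB -mulr_suml mixture_total // mul1r mixture_sum //.
  by rewrite -[X in X - _]/(xi_at m (bar n) e) xi_at_bar // subrr.
apply: (@le_trans _ _ (\sum_(c in C n) s c * (2 * (eta / 4 + beta c) - D c))).
  apply: ler_sum => c cC; apply: ler_wpM2l; first exact: s_ge0.
  have beta0 : 0 <= beta c by apply: sumr_ge0 => e' _; rewrite mulr_ge0 // invr_ge0.
  have h := circuit_density e (hC Nn cC) K0 mKn b0.
  have : D c <= eta / 4 + beta c by rewrite /D lerBlDl addrA.
  move: beta0; rewrite -/(D c); move: (D c) (beta c) => x y.
  by case: (ger0P x); lra.
under eq_bigr do rewrite mulrBr mulrCA mulrDr.
rewrite sumrB D0 -mulr_sumr big_split -mulr_suml mixture_total //= mul1r.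
by lra.
Unshelve. all: by end_near. Qed.

Lemma average_deviation_level m (eta : R) : 0 < eta ->
  \forall n \near \oo, N n -> \sum_(c in C n) s c *
    (\sum_(e : edges (S m)) `|xi_at m (tilde R c) e - bar m e|) <= eta.
Proof.
move=> eta0; pose eta' := eta / #|{: edges (S m)}|.+1%:R.
have eta'0 : 0 < eta' by rewrite divr_gt0.
have ev : \forall n \near \oo, forall e : edges (S m), N n ->
    \sum_(c in C n) s c * `|xi_at m (tilde R c) e - bar m e| <= eta'.
  by apply: filter_forall => e; exact: average_deviation_edge.
near=> n => Nn; under eq_bigr do rewrite mulr_sumr.
rewrite exchange_big /=; apply: (@le_trans _ _ (\sum_(e : edges (S m)) eta')).
  by apply: ler_sum => e _; apply: (near ev n).
rewrite sumr_const -mulr_natl mulrCA ger_pMr // ler_pdivrMr // mul1r ler_nat.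
exact: leqnSn.
Unshelve. all: by end_near. Qed.

Lemma average_deviation r (eta : R) : 0 < eta ->
  \forall n \near \oo, N n -> \sum_(c in C n) s c *
    (\sum_(m < r) \sum_(e : edges (S m)) `|xi_at m (tilde R c) e - bar m e|) <= eta.
Proof.
elim: r eta => [|r IH] eta eta0.
  near=> n => _; rewrite big1 ?ltW // => c _.
  by rewrite big_ord0 mulr0.
have eta2 : 0 < eta / 2 by rewrite divr_gt0.
have ev := IH _ eta2; have evr := @average_deviation_level r _ eta2.
near=> n => Nn.
under eq_bigr do rewrite big_ord_recr mulrDr.
rewrite big_split [leRHS](splitr eta) lerD //.
  by apply: (near ev n).
by apply: (near evr n).
Unshelve. all: by end_near. Qed.

(** All summands are nonnegative, so a circuit whose total deviation is at most
    the average is close to mu at every edge. *)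
Lemma good_circuit r : \forall n \near \oo, N n ->
  exists c, c \in C n /\ forall m (e : edges (S m)), (m < r)%N ->
    `|xi_at m (tilde R c) e - bar m e| <= r.+1%:R^-1.
Proof.
have eta0 : 0 < r.+1%:R^-1 :> R by rewrite invr_gt0.
have ev := average_deviation r eta0.
near=> n => Nn.
have dev : \sum_(c in C n) s c * (\sum_(m < r) \sum_(e : edges (S m))
    `|xi_at m (tilde R c) e - bar m e|) <= r.+1%:R^-1 by apply: (near ev n).
have [c cC dc] := average_le (fun c => @s_ge0 n c Nn) (mixture_total Nn) dev.
exists c; split => // m e mr; apply: le_trans dc.
rewrite (bigD1 (Ordinal mr)) //= (bigD1 e) //= -addrA lerDl addr_ge0 //.
  by apply: sumr_ge0.
by apply: sumr_ge0 => k _; apply: sumr_ge0.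
Unshelve. all: by end_near. Qed.

End Deviation.

(** * A convergent sequence of circuits *)

Theorem theorem4p22 (R : realType) (S : cover_seq)
    (mu : probability (borel_invlim S) R) (hmu : ergodic_measure mu)
    (N : set nat) (hN : infinite_set N)
    (C : forall n : nat, {set {set edges (S n)}})
    (hC : circuit_system N C) (hexpr : expresses N C mu) :
  limits_of_system N C (bar_measure mu).
Proof.
have weights n : {s : {set edges (S n)} -> R | N n ->
    (forall c, c \in C n -> 0 <= s c) /\
    (forall e, bar_measure mu n e = \sum_(c in C n) s c * tilde R c e)}.
  apply: cid; have [/hexpr[s sP]|nN] := pselect (N n); first by exists s.
  by exists (fun=> 0).
pose s n := sval (weights n); have sP n := svalP (weights n).
have s_ge0 n c : N n -> c \in C n -> 0 <= s n c by move=> /sP[+ _]; apply.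
have sE n e : N n -> bar_measure mu n e = \sum_(c in C n) s n c * tilde R c e.
  by move=> /sP[_]; apply.
pose Q n r (c : {set edges (S n)}) := c \in C n /\
  forall m (e : edges (S m)), (m < r)%N ->
    `|xi_at m (tilde R c) e - bar_measure mu m e| <= r.+1%:R^-1.
have [c [cC cQ]] : exists c : forall n, {set edges (S n)},
    (forall n, N n -> Q n 0%N (c n)) /\
    forall r, \forall n \near \oo, N n -> Q n r (c n).
  apply: diagonal_choice.
  - by move=> n; exact: finset.set0.
  - move=> n r r' c rr' [cC h]; split=> // m e mr.
    by rewrite (le_trans (h m e (leq_trans mr rr'))) // lef_pV2 ?posrE // ler_nat.
  - move=> n Nn.
    have avg0 : \sum_(c in C n) s n c * 0 <= 0 by rewrite big1 // => c _; rewrite mulr0.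
    have [c cC _] := average_le (fun c => @s_ge0 n c Nn) (mixture_total hC sE Nn) avg0.
    by exists c.
  - exact: (good_circuit hmu hC s_ge0 sE).
exists c; split=> [n /cC[]//|]; split; first by apply: bar_measure_delta; case: hmu.
move=> m; apply: ptws_cvg => e; apply/cvgrPdist_le => eps eps0.
pose r := maxn m.+1 (Num.bound eps^-1).
have rm : (m < r)%N by exact: leq_maxl.
have reps : r.+1%:R^-1 <= eps.
  rewrite -[eps]invrK lef_pV2 ?posrE ?invr_gt0 //.
  have epsV : 0 <= eps^-1 by rewrite invr_ge0 ltW.
  apply/ltW/(lt_le_trans (archi_boundP epsV)).
  by rewrite ler_nat leqW // leq_maxr.
rewrite near_withinE.
have [n0 _ cn0] := cQ r.
exists n0.+1 => // k /= n0k Nk.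
rewrite xi_atE ?(leq_ltn_trans (leq0n _) n0k) //; apply: le_trans reps.
rewrite distrC; have [] := cn0 (k + m)%N _ Nk.
  by rewrite /= (leq_trans (ltnW n0k)) // leq_addr.
by move=> _; apply.
Qed.
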